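(* Let $\mathcal X = (X, \{R_i\}_{i=0}^d)$ be a symmetric association scheme with $d\ge 1$. Assume that $\mathcal X$ is $P$-polynomial. Fix an ordering $\{E_i\}_{i=0}^d$ of the primitive idempotents of $\mathcal X$ (with $E_0=|X|^{-1}J$). Then the following are equivalent: (i) $\mathcal X$ is formally self-dual with respect to the ordering $\{E_i\}_{i=0}^d$; (ii) $\mathcal X$ is numerically self-dual with respect to the ordering $\{E_i\}_{i=0}^d$.
   Context: Let $d \ge 1$ be an integer. A ($d$-class) symmetric association scheme is a sequence $\mathcal X = (X, \{R_i\}_{i=0}^d)$ where $X$ is a finite nonempty set and $R_0,\ldots,R_d$ are nonempty subsets of $X\times X$ such that: (i) $X\times X$ is the disjoint union of $R_0,\ldots,R_d$; (ii) $R_0=\{(x,x): x\in X\}$; (iii) each $R_i$ is symmetric, i.e. $(x,y)\in R_i$ implies $(y,x)\in R_i$; (iv) there exist integers $p^h_{i,j}$ $(0\le h,i,j\le d)$, called the intersection numbers, such that for every $(x,y)\in R_h$, $p^h_{i,j}=|\{z\in X : (x,z)\in R_i,\ (z,y)\in R_j\}|$. The associate matrix $A_i\in \mathrm{Mat}_X(\mathbb C)$ has $(x,y)$-entry $1$ if $(x,y)\in R_i$ and $0$ otherwise. The matrices $\{A_i\}_{i=0}^d$ form a basis of a commutative algebra $\mathcal M$ (the Bose-Mesner algebra). $\mathcal M$ has a second basis $\{E_i\}_{i=0}^d$, the primitive idempotents, with $\sum_i E_i=I$, $E_iE_j=\delta_{i,j}E_i$, and $E_0=|X|^{-1}J$,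 where $J$ is the all ones matrix; an ordering of the primitive idempotents always has $E_0=|X|^{-1}J$. With respect to an ordering $\{E_i\}_{i=0}^d$, the first eigenmatrix $P$ and second eigenmatrix $Q$ in $\mathrm{Mat}_{d+1}(\mathbb C)$ (rows and columns indexed by $0,\ldots,d$) are defined by $A_j=\sum_{i=0}^d P_{i,j}E_i$ and $E_j=|X|^{-1}\sum_{i=0}^d Q_{i,j}A_i$ for $0\le j\le d$. The Krein parameters $q^h_{i,j}$ are defined by $E_i\circ E_j=|X|^{-1}\sum_{h=0}^d q^h_{i,j}E_h$ for $0\le i,j\le d$, where $\circ$ is the entry-wise product. $\mathcal X$ is formally self-dual with respect to the ordering $\{E_i\}_{i=0}^d$ if $P=Q$. $\mathcal X$ is numerically self-dual with respect to the ordering $\{E_i\}_{i=0}^d$ if $p^h_{i,j}=q^h_{i,j}$ for all $0\le h,i,j\le d$. $\mathcal X$ is $P$-polynomial if for all $0\le h,i,j\le d$: $p^h_{i,j}=0$ if one of $h,i,j$ is greater than the sum of the other two; and $p^h_{i,j}\ne 0$ if one of $h,i,j$ is equal to the sum of the other two. *)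

(* Defs.v *)
From HB Require Import structures.
From mathcomp Require Import all_boot all_order all_algebra.
From mathcomp Require Import reals complex.

Set Implicit Arguments.
Unset Strict Implicit.
Unset Printing Implicit Defensive.

Import GRing.Theory Num.Theory.

Local Open Scope ring_scope.

(* The intersection numbers are stored as data: as every relation is nonempty,
   [intersectionE] determines them uniquely. *)
Record assoc_scheme (X : finType) (d : nat) : Type := AssocScheme {
  scheme_rel :> 'I_d.+1 -> {set X * X};
  intersection : 'I_d.+1 -> 'I_d.+1 -> 'I_d.+1 -> nat;
  carrier_nonempty : (0 < #|X|)%N;
  scheme_rel_nonempty : forall i, scheme_rel i != set0;
  scheme_rel_cover : \bigcup_i scheme_rel i = [set: X * X];
  scheme_rel_disjoint :
    forall i j, i != j -> [disjoint scheme_rel i & scheme_rel j];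
  scheme_rel0 : scheme_rel ord0 = [set xy | xy.1 == xy.2];
  scheme_rel_sym :
    forall i x y, (x, y) \in scheme_rel i -> (y, x) \in scheme_rel i;
  intersectionE : forall h i j x y, (x, y) \in scheme_rel h ->
    intersection h i j =
      #|[set z | ((x, z) \in scheme_rel i) && ((z, y) \in scheme_rel j)]|
}.

Definition p_polynomial (X : finType) (d : nat) (S : assoc_scheme X d) : Prop :=
  forall h i j : 'I_d.+1,
    ([|| i + j < h, h + j < i | h + i < j]%N -> intersection S h i j = 0%N) /\
    ([|| h == i + j :> nat, i == h + j :> nat | j == h + i :> nat]%N ->
       intersection S h i j <> 0%N).

Section BoseMesner.
Variables (R : realType) (X : finType) (d : nat).

(* Mat_X(C): rows and columns are indexed by X through [enum_val]. *)
Local Notation mat := 'M[R[i]]_#|X|.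

Definition hadamard (A B : mat) : mat := map2_mx *%R A B.

Variable S : assoc_scheme X d.

Definition associate (i : 'I_d.+1) : mat :=
  \matrix_(x, y) ((enum_val x, enum_val y) \in S i)%:R.

Definition associates : d.+1.-tuple mat := [tuple associate i | i < d.+1].

Definition bose_mesner : {vspace mat} := <<associates>>%VS.

Definition family (E : 'I_d.+1 -> mat) : d.+1.-tuple mat :=
  [tuple E i | i < d.+1].

(* Pairwise orthogonal idempotents that form a basis of the Bose-Mesner algebra
   are exactly its primitive idempotents. *)
Record primitive_idempotents (E : 'I_d.+1 -> mat) : Prop :=
  PrimitiveIdempotents {
    idempotents_basis : basis_of bose_mesner (family E);
    idempotents_sum : \sum_i E i = 1%:M;
    idempotents_mul : forall i j, E i *m E j = if i == j then E i else 0;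
    idempotents0 : E ord0 = (#|X|%:R)^-1 *: const_mx 1
  }.

Variable E : 'I_d.+1 -> mat.

(* The following are read off as coordinates in the two bases; they satisfy the
   defining equations [first_eigenmatrixE], [second_eigenmatrixE] and [kreinE]
   below. *)
Definition first_eigenmatrix : 'M[R[i]]_d.+1 :=
  \matrix_(i, j) coord (family E) i (associate j).

Definition second_eigenmatrix : 'M[R[i]]_d.+1 :=
  \matrix_(i, j) (#|X|%:R * coord associates i (E j)).

Definition krein (h i j : 'I_d.+1) : R[i] :=
  #|X|%:R * coord (family E) h (hadamard (E i) (E j)).

Definition formally_self_dual : Prop := first_eigenmatrix = second_eigenmatrix.

Definition numerically_self_dual : Prop :=
  forall h i j : 'I_d.+1, (intersection S h i j)%:R = krein h i j.

Lemma card_carrier_neq0 : (#|X|%:R : R[i]) != 0.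
Proof. by rewrite pnatr_eq0 -lt0n (carrier_nonempty S). Qed.

Lemma nth_family (F : 'I_d.+1 -> mat) (i : 'I_d.+1) : (family F)`_i = F i.
Proof. by rewrite -tnth_nth tnth_mktuple. Qed.

Lemma scheme_rel_uniq i j xy : xy \in S i -> xy \in S j -> i = j.
Proof.
move=> xyi xyj; apply/eqP/negPn/negP => /(scheme_rel_disjoint S).
by move=> /disjointFr /(_ xyi); rewrite xyj.
Qed.

Lemma associates_basis : basis_of bose_mesner associates.
Proof.
rewrite /basis_of eqxx; apply/freeP => k sum0 i.
have /set0Pn[[x y] xyi] := scheme_rel_nonempty S i.
move/matrixP/(_ (enum_rank x) (enum_rank y)): sum0.
rewrite summxE (bigD1 i) //= big1 => [|j /negPf ji].
  by rewrite nth_family !mxE !enum_rankK xyi mulr1 addr0.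
rewrite nth_family !mxE !enum_rankK.
case xyj: ((x, y) \in S j); last by rewrite mulr0.
by rewrite (scheme_rel_uniq xyi xyj) eqxx in ji.
Qed.

Lemma associate_mem i : associate i \in bose_mesner.
Proof. by apply: memv_span; apply: map_f; rewrite mem_enum. Qed.

Lemma hadamard_mem A B :
  A \in bose_mesner -> B \in bose_mesner -> hadamard A B \in bose_mesner.
Proof.
move=> /(coord_basis associates_basis) -> /(coord_basis associates_basis) ->.
pose a := fun i => coord associates i A.
pose b := fun i => coord associates i B.
have -> : hadamard (\sum_i coord associates i A *: associates`_i)
      (\sum_i coord associates i B *: associates`_i) =
    \sum_i (a i * b i) *: associate i; last first.
  by apply: memv_suml => i _; apply/memvZ/associate_mem.
apply/matrixP => x y; rewrite !mxE !summxE.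
have : (enum_val x, enum_val y) \in \bigcup_i S i.
  by rewrite scheme_rel_cover inE.
case/bigcupP=> l _ xyl.
have eval (c : 'I_d.+1 -> R[i]) : \sum_i (c i *: associate i) x y = c l.
  rewrite (bigD1 l) //= big1 => [|j /negPf jl].
    by rewrite !mxE xyl mulr1 addr0.
  rewrite !mxE.
  case xyj: ((enum_val x, enum_val y) \in S j); last by rewrite mulr0.
  by rewrite (scheme_rel_uniq xyl xyj) eqxx in jl.
under eq_bigr do rewrite nth_family.
under [X in _ * X]eq_bigr do rewrite nth_family.
by rewrite !eval.
Qed.

Hypothesis primE : primitive_idempotents E.

Lemma first_eigenmatrixE j :
  associate j = \sum_i first_eigenmatrix i j *: E i.
Proof.
rewrite [LHS](coord_basis (idempotents_basis primE) (associate_mem j)).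
by apply: eq_bigr => i _; rewrite mxE nth_family.
Qed.

Lemma idempotent_mem j : E j \in bose_mesner.
Proof.
rewrite -(span_basis (idempotents_basis primE)).
by apply: memv_span; apply: map_f; rewrite mem_enum.
Qed.

Lemma second_eigenmatrixE j :
  E j = (#|X|%:R)^-1 *: \sum_i second_eigenmatrix i j *: associate i.
Proof.
rewrite [LHS](coord_basis associates_basis (idempotent_mem j)) scaler_sumr.
apply: eq_bigr => i _; rewrite mxE nth_family scalerA mulrA.
by rewrite mulVf ?mul1r ?card_carrier_neq0.
Qed.

Lemma kreinE i j :
  hadamard (E i) (E j) = (#|X|%:R)^-1 *: \sum_h krein h i j *: E h.
Proof.
rewrite [LHS](coord_basis (idempotents_basis primE)
  (hadamard_mem (idempotent_mem i) (idempotent_mem j))) scaler_sumr.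
apply: eq_bigr => h _; rewrite nth_family scalerA mulrA.
by rewrite mulVf ?mul1r ?card_carrier_neq0.
Qed.

End BoseMesner.

(* Main.v *)
Require Import Defs.
From mathcomp Require Import all_boot all_order all_algebra.
From mathcomp Require Import reals complex.

(** With [m_i] the rank of [E_i] and [k_j] the valency of [R_j], computing the
    trace of [A_j E_i] in the two bases yields [P_ij m_i = Q_ji k_j].  Each row
    of [P] (of [Q]) is a character of the algebra with structure constants
    [p^h_ij] (respectively [q^h_ij]), so [P = Q] forces [p = q] because [P] is
    invertible.  Conversely, if [p = q], then [k_j = p^0_jj = q^0_jj = m_j], and
    by P-polynomiality a row of [P] or [Q] is determined by its entry in column
    1.  As [P_11 = Q_11], the rows of index 1 agree; by the symmetry
    [P_ij k_i = Q_ji k_j] the columns of index 1 then agree, hence all rows. *)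

Import GRing.Theory Num.Theory.

Local Open Scope ring_scope.

Section SelfDuality.

Set Implicit Arguments.
Unset Strict Implicit.

(** The recurrence at [j] involves no index above [j.+1], and its coefficient at [j.+1] is
    cancellable, so it determines the value at [j.+1] from the earlier ones. *)
Lemma three_term_uniq (F : idomainType) (d : nat)
    (c : 'I_d.+1 -> 'I_d.+1 -> F) (f g : 'I_d.+1 -> F) (x : F) :
  (forall h j : 'I_d.+1, (j.+1 < h)%N -> c h j = 0) ->
  (forall h j : 'I_d.+1, h = j.+1 :> nat -> c h j != 0) ->
  (forall j, x * f j = \sum_h c h j * f h) ->
  (forall j, x * g j = \sum_h c h j * g h) ->
  f ord0 = g ord0 -> f =1 g.
Proof.
move=> c0 cN0 fE gE fg0.
suff fg n (i : 'I_d.+1) : (i <= n)%N -> f i = g i by move=> i; apply: (fg i).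
elim: n i => [|n IHn] i.
  by rewrite leqn0 => /eqP i0; have -> : i = ord0 by apply: val_inj.
rewrite leq_eqVlt => /orP[/eqP iSn|]; last exact: IHn.
have ltnd : (n < d.+1)%N by rewrite ltnW // -iSn ltn_ord.
pose j := Ordinal ltnd.
have ci := cN0 i j iSn; apply: (mulfI ci).
have := fE j; rewrite (IHn j) // gE (bigD1 i) //= [RHS](bigD1 i) //= => /esym.
suff -> : \sum_(h | h != i) c h j * f h = \sum_(h | h != i) c h j * g h.
  by move/addIr.
(* Indices up to [n] are settled by induction; any other [h != i] exceeds [n.+1], where the
   coefficient vanishes. *)
apply: eq_bigr => h hi.
have [hn|hn] := leqP h n; first by rewrite (IHn h hn).
by rewrite c0 ?mul0r // ltn_neqAle hn andbT -iSn eq_sym.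
Qed.

Variables (R : realType) (X : finType) (d : nat) (S : assoc_scheme X d).

Local Notation mat := 'M[R[i]]_#|X|.
Local Notation n := (#|X|%:R : R[i]).
Local Notation A := (associate R S).

Definition entry_sum (B : mat) : R[i] := \sum_x \sum_y B x y.

Lemma entry_sumZ a B : entry_sum (a *: B) = a * entry_sum B.
Proof.
rewrite /entry_sum mulr_sumr; apply: eq_bigr => x _; rewrite mulr_sumr.
by apply: eq_bigr => y _; rewrite mxE.
Qed.

Lemma entry_sum_sum (I : finType) (F : I -> mat) :
  entry_sum (\sum_i F i) = \sum_i entry_sum (F i).
Proof.
rewrite [RHS]exchange_big; apply: eq_bigr => x _.
by rewrite exchange_big; apply: eq_bigr => y _; rewrite summxE.
Qed.

(** Bridge between the matrix product, governed by the intersection numbers, and the entrywise one,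
    governed by the Krein parameters. *)
Lemma mxtrace_mul_sym (B C : mat) :
  C^T = C -> \tr (B *m C) = entry_sum (hadamard B C).
Proof.
move=> symC; apply: eq_bigr => x _; rewrite mxE; apply: eq_bigr => y _.
by rewrite !mxE -[in LHS]symC mxE.
Qed.

(** * Associate matrices: products, traces and entry sums *)

Lemma associate_sym i : (A i)^T = A i.
Proof.
apply/matrixP => x y; rewrite !mxE; congr (nat_of_bool _)%:R.
by apply/idP/idP; apply: scheme_rel_sym.
Qed.

Lemma associate_entry l x y (f : 'I_d.+1 -> R[i]) :
  (enum_val x, enum_val y) \in S l -> (\sum_i f i *: A i) x y = f l.
Proof.
move=> xyl; rewrite summxE (bigD1 l) //= big1 => [|j jl].
  by rewrite !mxE xyl mulr1 addr0.
rewrite !mxE; case xyj: (_ \in S j); last by rewrite mulr0.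
by rewrite (scheme_rel_uniq xyl xyj) eqxx in jl.
Qed.

Lemma scheme_rel_exists (x y : X) : exists l, (x, y) \in S l.
Proof.
have : (x, y) \in \bigcup_i S i by rewrite scheme_rel_cover inE.
by case/bigcupP => l _; exists l.
Qed.

Lemma scheme_rel_entry l :
  exists x y : 'I_#|X|, (enum_val x, enum_val y) \in S l.
Proof.
have /set0Pn[[x y] xyl] := scheme_rel_nonempty S l.
by exists (enum_rank x), (enum_rank y); rewrite !enum_rankK.
Qed.

Lemma associate_mul i j : A i *m A j = \sum_h (intersection S h i j)%:R *: A h.
Proof.
apply/matrixP => x y; have [l xyl] := scheme_rel_exists (enum_val x) (enum_val y).
rewrite (associate_entry _ xyl) (intersectionE _ _ xyl) mxE.
rewrite -sum1_card natr_sum [RHS](reindex _ (onW_bij _ (enum_val_bij X))).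
rewrite [RHS]big_mkcond; apply: eq_bigr => z _; rewrite !mxE inE -natrM mulnb.
by case: (_ && _).
Qed.

Lemma associate0 : A ord0 = 1%:M.
Proof.
apply/matrixP => x y; rewrite !mxE scheme_rel0 inE /=.
by rewrite (inj_eq enum_val_inj).
Qed.

Lemma mxtrace_associate i : \tr (A i) = n * (i == ord0)%:R.
Proof.
have [->|i0] := eqVneq i ord0; first by rewrite associate0 mxtrace1 mulr1.
rewrite mulr0 /mxtrace big1 // => x _; rewrite mxE.
case xxi: (_ \in _) => //; case/eqP: i0; apply: (scheme_rel_uniq xxi).
by rewrite scheme_rel0 inE.
Qed.

Lemma hadamard_associate i (c : 'I_d.+1 -> R[i]) :
  hadamard (A i) (\sum_j c j *: A j) = c i *: A i.
Proof.
apply/matrixP => x y; have [l xyl] := scheme_rel_exists (enum_val x) (enum_val y).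
rewrite !mxE (associate_entry _ xyl); case xyi: (_ \in S i).
  by rewrite (scheme_rel_uniq xyl xyi) mulrC.
by rewrite mul0r mulr0.
Qed.

(** A 0-1 matrix is its own entrywise square, so the entry sum is the trace of $A_j^2$, to which
    only $A_0 = I$ contributes. *)
Lemma entry_sum_associate j :
  entry_sum (A j) = n * (intersection S ord0 j j)%:R.
Proof.
transitivity (\tr (A j *m A j)).
  rewrite mxtrace_mul_sym ?associate_sym //; apply: eq_bigr => x _.
  by apply: eq_bigr => y _; rewrite !mxE -natrM mulnb andbb.
rewrite associate_mul raddf_sum (bigD1 ord0) //= big1 => [|h /negPf h0].
  by rewrite mxtraceZ mxtrace_associate mulr1 addr0 mulrC.
by rewrite mxtraceZ mxtrace_associate h0 !mulr0.
Qed.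

(** * Primitive idempotents and the two eigenmatrices *)

Variables (E : 'I_d.+1 -> mat) (primE : primitive_idempotents S E).

Local Notation P := (first_eigenmatrix S E).
Local Notation Q := (second_eigenmatrix S E).
Local Notation q := (krein E).

Lemma idempotent_sym i : (E i)^T = E i.
Proof.
rewrite (second_eigenmatrixE primE) linearZ linear_sum.
by congr (_ *: _); apply: eq_bigr => j _; rewrite linearZ /= associate_sym.
Qed.

Lemma idempotent_neq0 i : E i != 0.
Proof.
have /basis_free/free_not0 := idempotents_basis primE.
by apply; apply: map_f; rewrite mem_enum.
Qed.

Lemma associate_mul_idempotent i j : A j *m E i = P i j *: E i.
Proof.
rewrite (first_eigenmatrixE primE) mulmx_suml (bigD1 i) //= big1 => [|l li].
  by rewrite -scalemxAl (idempotents_mul primE) eqxx addr0.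
by rewrite -scalemxAl (idempotents_mul primE) (negPf li) scaler0.
Qed.

Lemma first_eigenmatrix0 l : P l ord0 = 1.
Proof.
apply/eqP; rewrite -subr_eq0.
have : (P l ord0 - 1) *: E l == 0.
  by rewrite scalerBl -associate_mul_idempotent associate0 mul1mx scale1r subrr.
by rewrite scaler_eq0 (negPf (idempotent_neq0 l)) orbF.
Qed.

(** Both sides are the scalar by which $A_i A_j$ acts on the nonzero matrix $E_l$. *)
Lemma first_eigenmatrix_mul l i j :
  P l i * P l j = \sum_h (intersection S h i j)%:R * P l h.
Proof.
apply/eqP; rewrite -subr_eq0; set c := _ - _.
have : c *: E l == 0.
  rewrite scalerBl subr_eq0 mulrC -scalerA -associate_mul_idempotent scalemxAr.
  rewrite -associate_mul_idempotent mulmxA associate_mul mulmx_suml scaler_suml.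
  apply/eqP/eq_bigr => h _.
  by rewrite -scalemxAl associate_mul_idempotent scalerA.
by rewrite scaler_eq0 (negPf (idempotent_neq0 l)) orbF => /eqP ->.
Qed.

Lemma second_eigenmatrix_entry l j x y :
  (enum_val x, enum_val y) \in S l -> Q l j = n * E j x y.
Proof.
move=> xyl; rewrite (second_eigenmatrixE primE) [in RHS]mxE (associate_entry _ xyl).
by rewrite mulrA mulfV ?mul1r // (card_carrier_neq0 _ S).
Qed.

Lemma second_eigenmatrix0 l : Q l ord0 = 1.
Proof.
have [x [y xyl]] := scheme_rel_entry l.
rewrite (second_eigenmatrix_entry _ xyl) (idempotents0 primE) !mxE mulr1.
by rewrite mulfV // (card_carrier_neq0 _ S).
Qed.

(** Dual of [first_eigenmatrix_mul]: taking the entry at a point of $R_l$ is multiplicative for the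
    entrywise product. *)
Lemma second_eigenmatrix_mul l i j :
  Q l i * Q l j = \sum_h q h i j * Q l h.
Proof.
have [x [y xyl]] := scheme_rel_entry l.
have n0 := card_carrier_neq0 R S.
have Exy := congr1 (fun B : mat => B x y) (kreinE primE i j).
rewrite !mxE summxE in Exy.
rewrite !(second_eigenmatrix_entry _ xyl) mulrACA Exy mulrA mulfK // mulr_sumr.
by apply: eq_bigr => h _; rewrite (second_eigenmatrix_entry _ xyl) mxE mulrCA.
Qed.

(** The entry sum is the trace of $J E_h$, and $J$ is a multiple of $E_0$, which is orthogonal to
    the other idempotents. *)
Lemma entry_sum_idempotent h : entry_sum (E h) = n * (h == ord0)%:R.
Proof.
have n0 := card_carrier_neq0 R S.
pose J : mat := const_mx 1.
have -> : entry_sum (E h) = \tr (J *m E h).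
  rewrite mxtrace_mul_sym ?idempotent_sym //; apply: eq_bigr => x _.
  by apply: eq_bigr => y _; rewrite !mxE mul1r.
have -> : J = n *: E ord0 by rewrite (idempotents0 primE) scalerA mulfV ?scale1r.
rewrite -scalemxAl mxtraceZ (idempotents_mul primE) [ord0 == h]eq_sym.
have [_|_] := eqVneq h ord0; last by rewrite mxtrace0.
rewrite (idempotents0 primE) mxtraceZ /mxtrace.
under eq_bigr do rewrite mxE.
by rewrite sumr_const card_ord mulVf.
Qed.

(** Dual of [entry_sum_associate]: here $E_j$ is its own matrix square, and only $E_0$ contributes
    to the entry sum of $E_j \circ E_j$. *)
Lemma mxtrace_idempotent j : \tr (E j) = q ord0 j j.
Proof.
have n0 := card_carrier_neq0 R S.
have -> : \tr (E j) = \tr (E j *m E j) by rewrite (idempotents_mul primE) eqxx.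
rewrite mxtrace_mul_sym ?idempotent_sym // (kreinE primE) entry_sumZ.
rewrite entry_sum_sum (bigD1 ord0) //= big1 => [|h /negPf h0].
  by rewrite entry_sumZ entry_sum_idempotent mulr1 addr0 mulrC mulfK.
by rewrite entry_sumZ entry_sum_idempotent h0 !mulr0.
Qed.

Lemma eigenmatrix_duality i j :
  P i j * q ord0 i i = Q j i * (intersection S ord0 j j)%:R.
Proof.
have n0 := card_carrier_neq0 R S.
rewrite -mxtrace_idempotent -mxtraceZ -associate_mul_idempotent.
rewrite mxtrace_mul_sym ?idempotent_sym // (second_eigenmatrixE primE).
rewrite scaler_sumr; under eq_bigr do rewrite scalerA.
rewrite (hadamard_associate j (fun l => _ * Q l i)) entry_sumZ.
by rewrite entry_sum_associate mulrACA mulVf // mul1r.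
Qed.

(** Invertibility of $P$ as a change of basis: the sums are the coordinates of $\sum_h f_h A_h$ in
    the idempotents, and the entries of this matrix recover [f]. *)
Lemma first_eigenmatrix_inj (f g : 'I_d.+1 -> R[i]) :
  (forall l, \sum_h f h * P l h = \sum_h g h * P l h) -> f =1 g.
Proof.
move=> fg h; have [x [y xyh]] := scheme_rel_entry h.
rewrite -(associate_entry f xyh) -(associate_entry g xyh).
have AE (c : 'I_d.+1 -> R[i]) :
    \sum_h c h *: A h = \sum_l (\sum_h c h * P l h) *: E l.
  under [RHS]eq_bigr do rewrite scaler_suml.
  rewrite exchange_big; apply: eq_bigr => i _.
  rewrite (first_eigenmatrixE primE) scaler_sumr.
  by apply: eq_bigr => l _; rewrite scalerA.
by rewrite !AE; under eq_bigr do rewrite fg.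
Qed.

Lemma formally_numerically_self_dual :
  formally_self_dual S E -> numerically_self_dual S E.
Proof.
move=> PQ h i j.
apply: (@first_eigenmatrix_inj (fun h => (intersection S h i j)%:R)
          (fun h => q h i j)) => l.
by rewrite -first_eigenmatrix_mul PQ second_eigenmatrix_mul.
Qed.

Lemma numerically_formally_self_dual : (1 <= d)%N -> p_polynomial S ->
  numerically_self_dual S E -> formally_self_dual S E.
Proof.
move=> d_ge1 S_ppoly pq.
pose o1 : 'I_d.+1 := Ordinal (d_ge1 : (1 < d.+1)%N).
pose k j : R[i] := (intersection S ord0 j j)%:R.
(* The triple $(0, j, j)$ satisfies $j = 0 + j$, so P-polynomiality makes the valency nonzero. *)
have k0 j : k j != 0.
  rewrite pnatr_eq0; apply/eqP; apply: (S_ppoly _ _ _).2.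
  by rewrite /= add0n eqxx !orbT.
have duality i j : P i j * k i = Q j i * k j.
  by rewrite /k pq eigenmatrix_duality.
have rowE l : P l o1 = Q l o1 -> P l =1 Q l.
  (* Multiplying by the entry in column 1 gives the recurrence with coefficients $p^h_{1,j}$, which
     are shared by both rows since $p = q$. *)
  move=> PQl; apply: (three_term_uniq
    (c := fun h j => (intersection S h o1 j)%:R) (x := P l o1)).
  - by move=> h j jh; rewrite (S_ppoly _ _ _).1 // add1n jh.
  - move=> h j hj; rewrite pnatr_eq0; apply/eqP; apply: (S_ppoly _ _ _).2.
    by rewrite hj add1n eqxx.
  - by move=> j; rewrite first_eigenmatrix_mul.
  - move=> j; rewrite PQl second_eigenmatrix_mul.
    by apply: eq_bigr => h _; rewrite pq.
  - by rewrite first_eigenmatrix0 second_eigenmatrix0.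
have row1 : P o1 =1 Q o1.
  by apply: rowE; apply: (mulIf (k0 o1)); apply: duality.
(* The chain is $P_{i1} k_i = Q_{1i} k_1 = P_{1i} k_1 = Q_{i1} k_i$. *)
apply/matrixP => i; apply: rowE; apply: (mulIf (k0 i)).
by rewrite duality -row1 duality.
Qed.

End SelfDuality.

Theorem theorem6p2 (R : realType) (X : finType) (d : nat) (d_ge1 : (1 <= d)%N)
  (S : assoc_scheme X d) (S_ppoly : p_polynomial S)
  (E : 'I_d.+1 -> 'M[R[i]]_#|X|) (primE : primitive_idempotents S E) :
  formally_self_dual S E <-> numerically_self_dual S E.
Proof.
split; first exact: formally_numerically_self_dual.
exact: numerically_formally_self_dual.
Qed.
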